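(* Let $R$ be a P$v$MD. The following conditions are equivalent: (i) $R$ is a $tRTP$-domain; (ii) each branched $t$-prime $P$ contains a finitely generated ideal $J$ such that $J\subseteq P$ and $J\not\subseteq M$ for each $t$-maximal ideal $M$ not containing $P$; (iii) each branched $t$-prime is the radical of a $v$-finite divisorial ideal; (iv) each nonzero principal ideal has at most finitely many minimal primes; (v) each nonzero finitely generated ideal has at most finitely many minimal $t$-primes; (vi) each $v$-finite divisorial ideal has at most finitely many minimal primes.
   Context: $R$ is an integral domain with quotient field $K\neq R$. For nonzero $R$-submodules $A,B$ of $K$, $(A:B)=\{x\in K: xB\subseteq A\}$. For a nonzero fractional ideal $I$, $I_v=(R:(R:I))$, $I_t=\bigcup\{J_v: J\subseteq I\text{ nonzero finitely generated}\}$; $I$ is divisorial if $I=I_v$, a $t$-ideal if $I=I_t$; a $v$-finite divisorial ideal is one of the form $J_v$ with $J$ finitely generated. A $t$-prime is a prime $t$-ideal; a $t$-maximal ideal is an ideal maximal among proper $t$-ideals. $R$ is a P$v$MD if $R_M$ is a valuation domain for every $t$-maximal $M$. A prime $P$ is branched if there is a $P$-primary ideal different from $P$. $R$ is a $tRTP$-domain ($t$-radical trace property) if for each nonzero ideal $I$ of $R$, either $(I(R:I))_t=R$ or $(I(R:I))_t$ is a radical ideal. *)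

(* Defs.v *)
From HB Require Import structures.
From mathcomp Require Import all_boot all_order all_algebra.
From Stdlib Require Lists.List.
Set Implicit Arguments. Unset Strict Implicit. Unset Printing Implicit Defensive.
Import GRing.Theory.
Local Open Scope ring_scope.

Section IdealDefs.
Variable R : idomainType.

Definition is_ideal (I : R -> Prop) :=
  [/\ I 0, (forall a b, I a -> I b -> I (a + b)) & (forall r a, I a -> I (r * a))].
Definition nonzeroI (I : R -> Prop) := exists a, I a /\ a != 0.
Definition subI (I J : R -> Prop) := forall a, I a -> J a.
Definition eqI (I J : R -> Prop) := forall a, I a <-> J a.
Definition properI (I : R -> Prop) := exists a, ~ I a.
Definition prime_ideal (P : R -> Prop) :=
  [/\ is_ideal P, properI P & forall a b, P (a * b) -> P a \/ P b].
Definition radical (I : R -> Prop) : R -> Prop := fun a => exists n, I (a ^+ n.+1).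
Definition radical_ideal (I : R -> Prop) := subI (radical I) I.
Definition primary_for (Q P : R -> Prop) :=
  [/\ is_ideal Q, properI Q, (forall a b, Q (a * b) -> ~ Q a -> radical Q b)
    & eqI (radical Q) P].
Definition branched (P : R -> Prop) :=
  prime_ideal P /\ exists Q, primary_for Q P /\ ~ eqI Q P.
Definition genI (s : seq R) : R -> Prop :=
  fun a => exists c : seq R, size c = size s /\ a = \sum_(i < size s) c`_i * s`_i.
Definition minimal_prime_of (I P : R -> Prop) :=
  [/\ prime_ideal P, subI I P &
      forall Q, prime_ideal Q -> subI I Q -> subI Q P -> eqI Q P].
Definition finitely_many (F : (R -> Prop) -> Prop) :=
  exists L : seq (R -> Prop), forall P, F P -> exists2 Q, Stdlib.Lists.List.In Q L & eqI P Q.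

Variables (K : fieldType) (iota : {rmorphism R -> K}).

Definition inR (x : K) := exists r, x = iota r.
Definition colonR (I : R -> Prop) : K -> Prop :=
  fun x => forall a, I a -> inR (x * iota a).
(* I_v = (R : (R : I)); for an integral ideal I this is contained in R
   (as 1 \in (R : I)), so we record it as a subset of R *)
Definition vclos (I : R -> Prop) : R -> Prop :=
  fun r => forall x, colonR I x -> inR (iota r * x).
Definition tclos (I : R -> Prop) : R -> Prop :=
  fun r => exists s : seq R, [/\ subI (genI s) I, nonzeroI (genI s) & vclos (genI s) r].
Definition t_ideal (I : R -> Prop) := [/\ is_ideal I, nonzeroI I & eqI (tclos I) I].
Definition t_prime (P : R -> Prop) := prime_ideal P /\ t_ideal P.
Definition t_maximal (M : R -> Prop) :=
  [/\ t_ideal M, properI M &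
      forall N, t_ideal N -> properI N -> subI M N -> eqI N M].
Definition minimal_tprime_of (I P : R -> Prop) :=
  [/\ t_prime P, subI I P &
      forall Q, t_prime Q -> subI I Q -> subI Q P -> eqI Q P].
Definition locR (M : R -> Prop) : K -> Prop :=
  fun x => exists a s, ~ M s /\ x = iota a / iota s.
Definition valuation_loc (M : R -> Prop) :=
  forall x : K, x != 0 -> locR M x \/ locR M x^-1.
Definition PvMD := forall M, t_maximal M -> valuation_loc M.
(* I (R : I), an integral ideal, recorded as a subset of R *)
Definition prodColon (I : R -> Prop) : R -> Prop :=
  fun r => exists s : seq (R * K),
    (forall p, p \in s -> I p.1 /\ colonR I p.2) /\
    iota r = \sum_(p <- s) iota p.1 * p.2.
Definition tRTP :=
  forall I, is_ideal I -> nonzeroI I ->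
    (forall r, tclos (prodColon I) r) \/ radical_ideal (tclos (prodColon I)).
End IdealDefs.

(* Main.v *)
Require Import Defs.
From HB Require Import structures.
From mathcomp Require Import all_boot all_order all_algebra.
From mathcomp Require Import ring.
From mathcomp Require Import boolp classical_sets.
Set Implicit Arguments. Unset Strict Implicit. Unset Printing Implicit Defensive.
Import GRing.Theory.
Local Open Scope ring_scope.

(* Everything is tested at the t-maximal ideals M, where divisibility in R_M is a
   total preorder.

   From a P-primary Q <> P, the trace property gives x in (R : Q) outside R_P; then
   the denominator ideal (R : (1, x)) is v-finite and lies between Q and P, so its
   radical is P. Minimal primes of a principal ideal are branched t-primes; if each
   is the radical of a v-finite ideal, Krull's separation lemma bounds their number.

   Conversely let T = I(R : I), c^2 in T_t, and let P be the minimal prime of c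
   inside M. Comparing valuations at P yields a in I with (c/a) I in P R_P, and
   some multiple s c^2, s outside M, is a finite sum of products in I(R : I). Its
   minimal primes other than P do not lie in M; being finitely many, they all
   contain some e outside M. Up to a factor u outside M, e c/a is then in (R : I),
   so that e u c is in T. *)

(** * Ideals, finite generating families and prime separation *)

Section Ideals.
Context {R : idomainType}.
Implicit Types (I J P Q : R -> Prop) (s : seq R).

Definition subseqI s I := forall x, x \in s -> I x.

(** Generators of the product of the ideals generated by [s] and [s']. *)
Definition mulseq s s' : seq R := [seq x * y | x <- s, y <- s'].

Section OneIdeal.
Context {I : R -> Prop} (hI : is_ideal I).

Lemma ideal0 : I 0. Proof. by case: hI. Qed.

Lemma idealD {a b} : I a -> I b -> I (a + b). Proof. by case: hI => _ + _; apply. Qed.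

Lemma idealM {a} r : I a -> I (r * a). Proof. by case: hI => _ _; apply. Qed.

Lemma ideal_mulr {a} r : I a -> I (a * r). Proof. by rewrite mulrC; apply: idealM. Qed.

Lemma ideal_top {a} : I 1 -> I a. Proof. by move/(idealM a); rewrite mulr1. Qed.

Lemma genI_sub s : subseqI s I -> subI (genI s) I.
Proof.
move=> h a [c [_ ->]]; elim/big_ind: _ => [||i _]; first exact: ideal0.
  by move=> *; apply: idealD.
by apply: idealM; apply: h; apply: mem_nth.
Qed.

End OneIdeal.

Lemma genI_ideal s : is_ideal (genI s).
Proof.
split.
- exists (nseq (size s) 0); rewrite size_nseq; split=> //.
  by rewrite big1 // => i _; rewrite nth_nseq if_same mul0r.
- move=> a b [c [hc ->]] [d [hd ->]].
  exists [seq c`_i + d`_i | i <- iota 0 (size s)].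
  rewrite size_map size_iota; split=> //.
  rewrite -big_split; apply: eq_bigr => i _ /=.
  by rewrite (nth_map 0%N) ?size_iota // nth_iota // mulrDl.
- move=> r a [c [hc ->]]; exists [seq r * x | x <- c]; rewrite size_map; split=> //.
  by rewrite mulr_sumr; apply: eq_bigr => i _; rewrite (nth_map 0) ?hc // mulrA.
Qed.

Lemma mem_genI s x : x \in s -> genI s x.
Proof.
move=> xs; have hi : (index x s < size s)%N by rewrite index_mem.
exists [seq ((i == index x s)%:R : R) | i <- iota 0 (size s)].
rewrite size_map size_iota; split=> //.
rewrite (bigD1 (Ordinal hi)) //= big1 ?addr0.
  by rewrite (nth_map 0%N) ?size_iota // nth_iota // eqxx mul1r nth_index.
move=> i /eqP ne; rewrite (nth_map 0%N) ?size_iota // nth_iota // add0n.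
by case: eqP => [e|]; [case: ne; apply: val_inj | rewrite mul0r].
Qed.

Lemma subI_genI s I : subI (genI s) I -> subseqI s I.
Proof. by move=> h x /mem_genI /h. Qed.

Lemma nonzero_genI s : nonzeroI (genI s) -> exists2 x, x \in s & x != 0.
Proof.
move=> [a [ga na]]; apply: contrapT => h.
have /eqP : a = 0; last by rewrite (negbTE na).
have hz : is_ideal (fun x : R => x = 0).
  by split=> // [x y -> ->|r x ->]; rewrite ?addr0 ?mulr0.
apply: (genI_sub hz _ ga) => x xs; apply: contrapT => /eqP nx.
by apply: h; exists x.
Qed.

Lemma genI_nonzero s x : x \in s -> x != 0 -> nonzeroI (genI s).
Proof. by move=> xs nx; exists x; split=> //; apply: mem_genI. Qed.

Lemma genI1P (a x : R) : genI [:: a] x <-> exists r, x = r * a.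
Proof.
split=> [[c [/= hc ->]]|[r ->]]; first by exists c`_0; rewrite big_ord1.
by apply: (idealM (genI_ideal _)); apply: mem_genI; rewrite inE.
Qed.

Lemma genI1_sub I (a : R) : is_ideal I -> I a -> subI (genI [:: a]) I.
Proof. by move=> hI Ia; apply: genI_sub => // x; rewrite inE => /eqP->. Qed.

Section OnePrime.
Context {P : R -> Prop} (hP : prime_ideal P).

Lemma prime_is_ideal : is_ideal P. Proof. by case: hP. Qed.

Lemma prime_nunit : ~ P 1.
Proof. by case: hP => pI [a na] _ /(ideal_top pI (a := a)). Qed.

Lemma primeM {a b} : ~ P a -> ~ P b -> ~ P (a * b).
Proof. by case: hP => _ _ h na nb /h []. Qed.

Lemma prime_neq0 {a} : ~ P a -> a != 0.
Proof. by move=> na; apply/eqP => a0; apply: na; rewrite a0; apply: ideal0 prime_is_ideal. Qed.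

Lemma primeX {a n} : P (a ^+ n) -> P a.
Proof.
elim: n => [|n ih]; first by rewrite expr0 => /prime_nunit.
by rewrite exprS; case: hP => _ _ h /h [//|/ih].
Qed.

Lemma primeMl {a b} : P (a * b) -> ~ P a -> P b.
Proof. by case: hP => _ _ h /h []. Qed.

Lemma prime_mulseq s s' : subseqI (mulseq s s') P -> subseqI s P \/ subseqI s' P.
Proof.
move=> h; case: (EM (subseqI s P)) => [|ns]; [by left | right=> y ys].
apply: contrapT => ny; apply: ns => x xs; apply: contrapT => nx.
by apply: (primeM nx ny); apply: h; apply: allpairs_f.
Qed.


End OnePrime.

Definition ideal_adjoin I (x : R) : R -> Prop := fun a => exists2 i, I i & exists r, a = i + r * x.

Lemma ideal_adjoin_ideal I x : is_ideal I -> is_ideal (ideal_adjoin I x).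
Proof.
move=> hI; split.
- by exists 0; [exact: ideal0 hI | exists 0; rewrite mul0r addr0].
- move=> a b [i hi [r ->]] [j hj [t ->]]; exists (i + j); first exact: idealD.
  by exists (r + t); ring.
- move=> t a [i hi [r ->]]; exists (t * i); first exact: idealM.
  by exists (t * r); ring.
Qed.

(* Krull's separation lemma for finite families instead of elements: it yields
   prime ideals avoiding a multiplicative set as well as t-maximal ideals. *)
Lemma krull (S : seq R -> Prop) I :
    is_ideal I -> (exists s, S s) ->
    (forall s s', S s -> S s' -> S (mulseq s s')) ->
    (forall s, S s -> ~ subseqI s I) ->
  exists P, [/\ prime_ideal P, subI I P, (forall s, S s -> ~ subseqI s P) &
    forall N, is_ideal N -> subI P N -> (forall s, S s -> ~ subseqI s N) -> subI N P].
Proof.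
move=> hI [s0 Ss0] Smul nSI.
pose good (A : R -> Prop) :=
  [/\ is_ideal A, subI I A & forall s, S s -> ~ subseqI s A].
pose F : set (set R) := fun A => A = (fun _ => False) \/ good A.
have [F' FF tot|A [FA maxA]] := @Zorn_bigcup R F.
  have [[B [FB [b Bb]]]|noB] := EM (exists B, F' B /\ exists b, B b); last first.
    left; apply/funext => x; apply/propext; split=> // - [B FB Bx]; apply: noB.
    by exists B; split=> //; exists x.
  have goodX X x : F' X -> X x -> good X by move=> /FF [->|].
  have gB := goodX _ _ FB Bb.
  have two X Y x y : F' X -> X x -> F' Y -> Y y -> exists Z, [/\ F' Z, Z x & Z y].
    by move=> FX Xx FY Yy; have [h|h] := tot _ _ FX FY;
      [exists Y | exists X]; split=> //; apply: h.
  right; split.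
  - split.
    + by exists B => //; case: gB => iB _ _; exact: ideal0 iB.
    + move=> x y [X FX Xx] [Y FY Yy]; have [Z [FZ Zx Zy]] := two _ _ _ _ FX Xx FY Yy.
      by exists Z => //; have [iZ _ _] := goodX _ _ FZ Zx; apply: (idealD iZ).
    + move=> r x [X FX Xx]; exists X => //.
      by have [iZ _ _] := goodX _ _ FX Xx; apply: (idealM iZ).
  - by move=> x Ix; exists B => //; case: gB => _ + _; apply.
  - move=> s Ss hs.
    (* The family [s] is finite, so a single member of the chain already contains it. *)
    have : exists2 Z, F' Z & subseqI s Z.
      elim: {Ss} s hs => [|x s ih] hs; first by exists B.
      have [|Z FZ hZ] := ih; first by move=> y ys; apply: hs; rewrite inE ys orbT.
      have [X FX Xx] : exists2 X, F' X & X x by apply: hs; rewrite inE eqxx.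
      have [h|h] := tot _ _ FZ FX.
        by exists X => // y; rewrite inE => /orP [/eqP->|/hZ /h].
      by exists Z => // y; rewrite inE => /orP [/eqP->|/hZ //]; apply: h.
    move=> [Z FZ hZ].
    have [[z Zz]|nz] := EM (exists z, Z z).
      by have [_ _ /(_ s Ss)] := goodX _ _ FZ Zz; apply.
    case: gB => _ _ /(_ s Ss); apply => x xs; case: nz; exists x; exact: hZ.
have gA : good A.
  case: FA => [A0|//]; case: (maxA I); last by right; split.
  by rewrite A0; split=> [x []|/(_ 0 (ideal0 hI)) []].
have [iA sA nA] := gA.
have mxA N : is_ideal N -> subI A N -> (forall s, S s -> ~ subseqI s N) -> subI N A.
  move=> iN AN nN; apply: contrapT => h; apply: (maxA N); last first.
    by right; split=> // x /sA /AN.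
  by split.
exists A; split=> //; split=> //.
  apply: contrapT => h; case: (nA _ Ss0) => x _.
  by apply: contrapT => nx; apply: h; exists x.
move=> a b Aab; have [|na] := EM (A a); [by left | right].
apply: contrapT => nb.
(* By maximality [A + Ra] and [A + Rb] contain families from [S]; their product family would lie in
   [A], because [ab] does. *)
have ex x : ~ A x -> exists2 s, S s & subseqI s (ideal_adjoin A x).
  move=> nx; apply: contrapT => h; apply: nx.
  apply: (mxA (ideal_adjoin A x)); first exact: ideal_adjoin_ideal.
  - by move=> y Ay; exists y => //; exists 0; rewrite mul0r addr0.
  - by move=> s Ss hs; apply: h; exists s.
  - by exists 0; [exact: ideal0 iA | exists 1; rewrite mul1r add0r].
have [s Ss hs] := ex _ na; have [s' Ss' hs'] := ex _ nb.
apply: (nA _ (Smul _ _ Ss Ss')) => _ /allpairsP [[x y] /= [xs ys ->]].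
have [[i Ai [r ->]] [j Aj [t ->]]] := (hs _ xs, hs' _ ys).
have -> : (i + r * a) * (j + t * b) = (j + t * b) * i + (r * a) * j + (r * t) * (a * b) by ring.
by apply: (idealD iA); [apply: (idealD iA)|]; apply: (idealM iA).
Qed.

(** In [R_P] the maximal ideal is the radical of [I R_P]. Otherwise the products [c b^n] with [c]
    outside [P] avoid [I], and a prime over [I] avoiding them lies inside [P] (take [n = 0]) but
    misses [b] (take [n = 1]), against minimality. *)
Lemma minimal_prime_pow I P b : is_ideal I -> minimal_prime_of I P -> P b ->
  exists c n, ~ P c /\ I (c * b ^+ n).
Proof.
move=> hI [pP IP minP] Pb; apply: contrapT => h.
pose S s := exists c n, ~ P c /\ s = [:: c * b ^+ n].
have [|||Q [pQ IQ nQ _]] := @krull S I hI.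
- by exists [:: 1 * b ^+ 0], 1, 0%N; split=> //; exact: prime_nunit.
- move=> _ _ [c [n [nc ->]]] [d [m [nd ->]]]; exists (c * d), (n + m)%N.
  by split; [exact: primeM | rewrite /mulseq /= exprD mulrACA].
- move=> _ [c [n [nc ->]]] hs; apply: h; exists c, n; split=> //.
  by apply: hs; rewrite inE.
have QP : subI Q P.
  move=> x Qx; apply: contrapT => nx; apply: (nQ [:: x * b ^+ 0]); first by exists x, 0%N.
  by move=> y; rewrite inE => /eqP->; rewrite expr0 mulr1.
apply: (nQ [:: 1 * b ^+ 1]); first by exists 1, 1%N; split=> //; exact: prime_nunit.
by move=> y; rewrite inE => /eqP->; rewrite mul1r expr1; apply/(minP Q).
Qed.

End Ideals.

Lemma eqI_eq (R : idomainType) (P Q : R -> Prop) : eqI P Q -> P = Q.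
Proof. by move=> h; apply/funext => x; apply/propext; apply: h. Qed.

(** * The v- and t-operations and t-maximal ideals *)

Section TOperation.
Context {R : idomainType} {K : fieldType} {iota : {rmorphism R -> K}}.
Implicit Types (I M N P : R -> Prop) (s : seq R) (x : K).
Local Notation inR := (inR iota).
Local Notation vclos := (vclos iota).
Local Notation tclos := (tclos iota).
Local Notation t_ideal := (t_ideal iota).
Local Notation t_prime := (t_prime iota).
Local Notation t_maximal := (t_maximal iota).

Lemma inR_iota r : inR (iota r). Proof. by exists r. Qed.

Lemma inRD x y : inR x -> inR y -> inR (x + y).
Proof. by move=> [a ->] [b ->]; exists (a + b); rewrite rmorphD. Qed.

Lemma inRM x y : inR x -> inR y -> inR (x * y).
Proof. by move=> [a ->] [b ->]; exists (a * b); rewrite rmorphM. Qed.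

Lemma denom_ideal x : is_ideal (fun r => inR (iota r * x)).
Proof.
split.
- by rewrite rmorph0 mul0r -(rmorph0 iota); apply: inR_iota.
- by move=> a b ha hb; rewrite rmorphD mulrDl; apply: inRD.
- by move=> r a ha; rewrite rmorphM -mulrA; apply: inRM => //; apply: inR_iota.
Qed.

(** The denominators of a fixed [x] form an ideal, so integrality against [x] need only be tested on
    generators. *)
Lemma vclosP s r :
  vclos (genI s) r <->
  forall x, (forall a, a \in s -> inR (iota a * x)) -> inR (iota r * x).
Proof.
split=> h x hx; apply: h => a; last by move=> /mem_genI /hx; rewrite mulrC.
by rewrite mulrC; move: a; apply: (genI_sub (denom_ideal x)) => a /hx.
Qed.

Lemma vclos_sub s I r : subseqI s I -> vclos (genI s) r ->
  forall x, (forall a, I a -> inR (iota a * x)) -> inR (iota r * x).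
Proof. by move=> sI /vclosP h x hx; apply: h => a /sI /hx. Qed.

Lemma vclos_ideal I : is_ideal (vclos I).
Proof.
split.
- by move=> x _; apply: ideal0 (denom_ideal x).
- by move=> a b ha hb x hx; apply: (idealD (denom_ideal x)); [apply: ha | apply: hb].
- by move=> r a ha x hx; apply: (idealM (denom_ideal x)); apply: ha.
Qed.

Lemma sub_vclos I : subI I (vclos I).
Proof. by move=> a Ia x hx; rewrite mulrC; apply: hx. Qed.

Lemma vclos_mono s s' r : {subset s <= s'} -> vclos (genI s) r -> vclos (genI s') r.
Proof. by move=> ss /vclosP h; apply/vclosP => x hx; apply: h => a /ss /hx. Qed.

(** [tclos] admits only families generating a nonzero ideal, so a nonzero element of [I] is put in
    front of [s]. *)
Lemma sub_tclos_seq I s r : is_ideal I -> nonzeroI I ->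
  subseqI s I -> vclos (genI s) r -> tclos I r.
Proof.
move=> hI [a [Ia na]] sI hr; exists (a :: s); split.
- by apply: genI_sub => // x; rewrite inE => /orP [/eqP->|/sI].
- by apply: (genI_nonzero (x := a)); rewrite ?inE ?eqxx.
- by apply: vclos_mono hr => x xs; rewrite inE xs orbT.
Qed.

Lemma tclos_seq I r : tclos I r -> exists2 s, subseqI s I & vclos (genI s) r.
Proof. by move=> [s [/subI_genI sI _ hr]]; exists s. Qed.

Section Closure.
Context {I : R -> Prop} (hI : is_ideal I) (nzI : nonzeroI I).

Lemma sub_tclos : subI I (tclos I).
Proof.
move=> a Ia; apply: (@sub_tclos_seq I [:: a]) => //.
  by move=> x; rewrite inE => /eqP->.
by apply/sub_vclos/mem_genI; rewrite inE.
Qed.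

Lemma tclos_ideal : is_ideal (tclos I).
Proof.
split.
- by apply: sub_tclos; apply: ideal0 hI.
- move=> a b /tclos_seq [s sI ha] /tclos_seq [s' sI' hb].
  apply: (@sub_tclos_seq I (s ++ s')) => //.
    by move=> x; rewrite mem_cat => /orP [/sI|/sI'].
  apply: (idealD (vclos_ideal _)).
    by apply: vclos_mono ha => x xs; rewrite mem_cat xs.
  by apply: vclos_mono hb => x xs; rewrite mem_cat xs orbT.
- move=> r a /tclos_seq [s sI ha]; apply: (@sub_tclos_seq I s) => //.
  by apply: (idealM (vclos_ideal _)).
Qed.

Lemma tclos_family s : subseqI s (tclos I) ->
  exists2 s', subseqI s' I & subseqI s (vclos (genI s')).
Proof.
elim: s => [_|a s ih h]; first by exists [::].
have [|s1 s1I hs1] := ih; first by move=> x xs; apply: h; rewrite inE xs orbT.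
have /tclos_seq [s2 s2I ha] : tclos I a by apply: h; rewrite inE eqxx.
exists (s2 ++ s1); first by move=> x; rewrite mem_cat => /orP [/s2I|/s1I].
move=> x; rewrite inE => /orP [/eqP->|/hs1].
  by apply: vclos_mono ha => y ys; rewrite mem_cat ys.
by apply: vclos_mono => y ys; rewrite mem_cat ys orbT.
Qed.

End Closure.

(** A nonzero ideal has t-closure [R] exactly when it contains such a family. These families are
    what the separation lemma must avoid to produce t-maximal ideals. *)
Definition unit_family s := vclos (genI s) 1.

Lemma unit_familyP s :
  unit_family s <-> forall x, (forall a, a \in s -> inR (iota a * x)) -> inR x.
Proof. by split=> [/vclosP h x /h|h]; [|apply/vclosP=> x /h]; rewrite rmorph1 mul1r. Qed.

(** If all [a b x] are integral, the second family makes every [a x] integral, and then the first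
    makes [x] integral. *)
Lemma unit_family_mul s s' :
  unit_family s -> unit_family s' -> unit_family (mulseq s s').
Proof.
move=> /unit_familyP hs /unit_familyP hs'; apply/unit_familyP => x hx.
apply: hs => a sa; apply: hs' => b sb.
by rewrite mulrA (mulrC (iota b)) -rmorphM; apply/hx/allpairs_f.
Qed.

Lemma unit_family_ideal_tclos I s : unit_family s -> is_ideal I -> nonzeroI I ->
  subseqI s (tclos I) -> exists2 s', subseqI s' I & unit_family s'.
Proof.
move=> /unit_familyP us hI nzI /tclos_family [s' s'I hs'].
exists s' => //; apply/unit_familyP => x hx; apply: us => a /hs' /vclosP; exact.
Qed.

Lemma t_ideal_unit_family N s :
  t_ideal N -> Defs.properI N -> unit_family s -> ~ subseqI s N.
Proof.
move=> [iN nzN tN] [a na] us sN; apply: na; apply: (ideal_top iN).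
by apply/tN; apply: (sub_tclos_seq (s := s)).
Qed.

(** Let [M] be maximal among the ideals over [I] that contain no unit family. A unit family in the
    t-closure of [M] would yield one in [M], so by maximality [M] is t-closed; a proper t-ideal
    contains no unit family, so [M] is t-maximal. *)
Lemma t_maximal_ex I : is_ideal I -> nonzeroI I ->
    (forall s, unit_family s -> ~ subseqI s I) ->
  exists M, [/\ t_maximal M, prime_ideal M & subI I M].
Proof.
move=> hI [a [Ia na]] nU.
have [|M [pM IM nM maxM]] := krull hI _ unit_family_mul nU.
  by exists [:: 1]; apply/sub_vclos/mem_genI; rewrite inE.
have iM := prime_is_ideal pM.
have nzM : nonzeroI M by exists a; split=> //; apply: IM.
exists M; split=> //; split.
- split=> // x; split; last exact: sub_tclos.
  apply: maxM => //; [exact: tclos_ideal | exact: sub_tclos |].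
  move=> s us sT; have [s' s'M us'] := unit_family_ideal_tclos us iM nzM sT.
  exact: nM us' s'M.
- by case: pM.
- move=> N tN pN MN x; split; last exact: MN.
  apply: maxM => //; first by case: tN.
  by move=> s us; apply: t_ideal_unit_family.
Qed.

Lemma t_maximal_prime M : t_maximal M -> prime_ideal M.
Proof.
move=> [tM pM maxM]; have [iM nzM _] := tM.
have [|N [[tN pN _] prN MN]] := t_maximal_ex iM nzM.
  by move=> s us; apply: t_ideal_unit_family.
by rewrite -(eqI_eq (maxM N tN pN MN)).
Qed.

(** The local-global principle: an ideal lying in no t-maximal ideal does so because of finitely
    many of its elements. *)
Lemma unit_family_ex I : is_ideal I -> nonzeroI I ->
    (forall M, t_maximal M -> exists2 a, I a & ~ M a) ->
  exists2 s, subseqI s I & unit_family s.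
Proof.
move=> iI nzI h; apply: contrapT => nU.
have [|M [tM _ IM]] := t_maximal_ex iI nzI.
  by move=> s us sI; apply: nU; exists s.
by have [a /IM] := h M tM.
Qed.

Lemma unit_family_t_maximal M s : t_maximal M -> unit_family s ->
  exists2 a, a \in s & ~ M a.
Proof.
move=> [tM pM _] us; apply: contrapT => h; apply: (t_ideal_unit_family tM pM us).
by move=> a sa; apply: contrapT => na; apply: h; exists a.
Qed.

(** The [d] with [d r] in [I] form an ideal lying in no t-maximal ideal, hence contain a unit
    family; its multiples by [r] lie in [I] and have [r] in their v-closure. *)
Lemma tclos_local I r : is_ideal I -> nonzeroI I ->
    (forall M, t_maximal M -> exists2 t, I (t * r) & ~ M t) -> tclos I r.
Proof.
move=> iI nzI h.
have iD : is_ideal (fun d => I (d * r)).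
  split; first by rewrite mul0r; apply: ideal0 iI.
  - by move=> a b; rewrite mulrDl; apply: idealD.
  - by move=> t a; rewrite -mulrA; apply: idealM.
have nzD : nonzeroI (fun d => I (d * r)).
  by have [a [Ia na]] := nzI; exists a; split=> //; apply: (ideal_mulr iI).
have [s sD /unit_familyP us] := unit_family_ex iD nzD h.
apply: (@sub_tclos_seq I [seq d * r | d <- s]) => //.
  by move=> _ /mapP [d /sD Id ->].
apply/vclosP => x hx; apply: us => d sd; rewrite mulrA -rmorphM.
by apply/hx/map_f.
Qed.

Context (quot : forall x : K, exists a b : R, b != 0 /\ x = iota a / iota b).
Context (iota_inj : injective iota).

Lemma iota_eq0 a : (iota a == 0) = (a == 0).
Proof. by rewrite -(rmorph0 iota) (inj_eq iota_inj). Qed.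

Lemma denom_nonzero x : nonzeroI (fun r => inR (iota r * x)).
Proof.
have [a [b [nb ->]]] := quot x; exists b; split=> //; exists a.
by rewrite mulrC divfK // iota_eq0.
Qed.

(** This is [R] as the intersection of the [R_M]: the denominator ideal of [x] contains a unit
    family. *)
Lemma inR_local x :
  (forall M, t_maximal M -> exists2 t, inR (iota t * x) & ~ M t) -> inR x.
Proof.
move=> h; have [s sD /unit_familyP] := unit_family_ex (denom_ideal x) (denom_nonzero x) h.
by apply.
Qed.

Lemma t_prime_t_maximal P : t_prime P -> exists2 M, t_maximal M & subI P M.
Proof.
move=> [[iP pP _] tP]; have [_ nzP _] := tP.
have [|M [tM _ PM]] := t_maximal_ex iP nzP; last by exists M.
by move=> s us; apply: t_ideal_unit_family.
Qed.

End TOperation.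

Arguments unit_family {R K} iota s.

(** * Divisibility in a localization, and valuation domains *)

Section LocalDivisibility.
Context {R : idomainType}.
Implicit Types (M P Q : R -> Prop) (a b c d : R) (s : seq R).

(** Divisibility of [b] by [a] in [R_M], with denominators cleared so as to stay in [R]. *)
Definition ldvd M a b := exists t c, ~ M t /\ t * b = c * a.

(** For a prime [M] this says that [R_M] is a valuation domain. *)
Definition ltotal M := forall a b, ldvd M a b \/ ldvd M b a.

(* The radical of the principal ideal [c R_M], contracted to [R]. *)
Definition lrad M c : R -> Prop := fun r => exists n, ldvd M c (r ^+ n).

Lemma ldvd_antimono M P a b : subI P M -> ldvd M a b -> ldvd P a b.
Proof. by move=> PM [t [c [nt e]]]; exists t, c; split=> // /PM. Qed.

Lemma ltotal_antimono M P : subI P M -> ltotal M -> ltotal P.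
Proof. by move=> PM h a b; case: (h a b) => /(ldvd_antimono PM); [left | right]. Qed.

Lemma ldvd_prime M Q a b : prime_ideal Q -> subI Q M -> ldvd M a b -> Q a -> Q b.
Proof.
move=> pQ QM [t [c [nt e]]] Qa; apply: (primeMl pQ (a := t)); last by move/QM.
by rewrite e; apply: (idealM (prime_is_ideal pQ)).
Qed.

Section Prime.
Context {M : R -> Prop} (pM : prime_ideal M).
Let n1 : ~ M 1 := prime_nunit pM.

Lemma ldvd_mull a c : ldvd M a (c * a).
Proof. by exists 1, c; rewrite mul1r. Qed.

Lemma ldvd_refl a : ldvd M a a.
Proof. by rewrite -{2}[a]mul1r; apply: ldvd_mull. Qed.

Lemma ldvd_out t b : ~ M t -> ldvd M t b.
Proof. by move=> nt; exists t, b; split=> //; rewrite mulrC. Qed.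

Lemma ldvd_trans b a c : ldvd M a b -> ldvd M b c -> ldvd M a c.
Proof.
move=> [t [d [nt e]]] [t' [d' [nt' e']]]; exists (t * t'), (d' * d).
split; first exact: primeM.
by rewrite -mulrA e' mulrCA e mulrA.
Qed.

Lemma ldvd_mul a b c d : ldvd M a b -> ldvd M c d -> ldvd M (a * c) (b * d).
Proof.
move=> [t [x [nt e]]] [t' [x' [nt' e']]]; exists (t * t'), (x * x').
split; first exact: primeM.
by rewrite mulrACA e e' mulrACA.
Qed.

Lemma ldvd_mulr a b c : ldvd M a b -> ldvd M a (c * b).
Proof. by move/ldvd_trans; apply; apply: ldvd_mull. Qed.

Lemma ldvdD a b c : ldvd M a b -> ldvd M a c -> ldvd M a (b + c).
Proof.
move=> [t [x [nt e]]] [t' [x' [nt' e']]]; exists (t * t'), (t' * x + t * x').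
split; first exact: primeM.
have -> : t * t' * (b + c) = t' * (t * b) + t * (t' * c) by ring.
by rewrite e e'; ring.
Qed.

Lemma ldvdX a b n : ldvd M a b -> ldvd M (a ^+ n) (b ^+ n).
Proof.
move=> h; elim: n => [|n ih]; first by rewrite !expr0; apply: ldvd_refl.
by rewrite !exprS; apply: ldvd_mul.
Qed.

Lemma ldvd_cancel c a b : c != 0 -> ldvd M (a * c) (b * c) -> ldvd M a b.
Proof.
move=> nc [t [x [nt e]]]; exists t, x; split=> //.
by apply: (mulIf nc); rewrite -!mulrA.
Qed.

Lemma ldvd_common_denom a s : (forall b, b \in s -> ldvd M a b) ->
  exists2 t, ~ M t & forall b, b \in s -> exists c, t * b = c * a.
Proof.
elim: s => [|b s ih] h; first by exists 1.
have [|t nt ht] := ih; first by move=> x xs; apply: h; rewrite inE xs orbT.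
have [t' [c [nt' e]]] := h b (mem_head _ _).
exists (t * t'); first exact: primeM.
move=> x; rewrite inE => /orP [/eqP->|/ht [d ed]].
  by exists (t * c); rewrite -mulrA e mulrA.
by exists (t' * d); rewrite mulrAC ed mulrC mulrA.
Qed.

Section Total.
Context (totM : ltotal M).

Lemma ldvd_out_in P t r : prime_ideal P -> subI P M -> ~ P t -> P r -> ldvd M t r.
Proof.
move=> pP PM nt Pr; have [//|h] := totM t r.
by case: nt; apply: ldvd_prime h Pr.
Qed.

(* [P R_P] is contained in [R_M]. *)
Lemma ldvd_lift P a b r : prime_ideal P -> subI P M -> ldvd P a b -> P r ->
  ldvd M a (b * r).
Proof.
move=> pP PM [t [c [nt e]]] Pr.
have [s [d [ns es]]] := ldvd_out_in pP PM nt Pr.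
exists s, (d * c); split=> //.
by rewrite mulrCA es mulrCA [b * t]mulrC e mulrA.
Qed.

(** An entry of least value generates the ideal of [s] locally. It is required to be nonzero so that
    one can divide by it. *)
Lemma ldvd_min s : (exists2 x, x \in s & x != 0) ->
  exists a, [/\ a \in s, a != 0 & forall b, b \in s -> ldvd M a b].
Proof.
elim: s => [[x //]|y s ih] [x xs nx].
have [[a [sa na ha]]|nos] := EM (exists a, [/\ a \in s, a != 0 &
                                   forall b, b \in s -> ldvd M a b]).
  have [y0|ny] := eqVneq y 0.
    exists a; rewrite inE sa orbT; split=> // b; rewrite inE => /orP [/eqP->|/ha //].
    by rewrite y0 -(mul0r a); apply: ldvd_mull.
  have [h|h] := totM a y.
    by exists a; rewrite inE sa orbT; split=> // b; rewrite inE => /orP [/eqP->|/ha].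
  exists y; rewrite inE eqxx; split=> // b; rewrite inE => /orP [/eqP->|/ha].
    exact: ldvd_refl.
  exact: ldvd_trans.
have z0 z : z \in s -> z = 0.
  by move=> zs; apply/eqP; apply: contraPT nos => nz; apply; apply: ih; exists z.
move: xs; rewrite inE => /orP [/eqP exy|/z0 x0]; last by rewrite x0 eqxx in nx.
exists y; rewrite inE eqxx -exy; split=> // b; rewrite inE => /orP [/eqP->|/z0->].
  by rewrite exy; apply: ldvd_refl.
by rewrite -(mul0r x); apply: ldvd_mull.
Qed.

Lemma lrad_self c : lrad M c c.
Proof. by exists 1%N; rewrite expr1; apply: ldvd_refl. Qed.

Lemma lrad_least c Q : prime_ideal Q -> subI Q M -> Q c -> subI (lrad M c) Q.
Proof. by move=> pQ QM Qc r [n h]; apply: (primeX pQ (n := n)); apply: ldvd_prime h Qc. Qed.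

Lemma lrad_sub c : M c -> subI (lrad M c) M.
Proof. exact: lrad_least. Qed.

Lemma lrad_prime c : M c -> prime_ideal (lrad M c).
Proof.
move=> Mc.
have lradM r x : lrad M c x -> lrad M c (r * x).
  by move=> [n h]; exists n; rewrite exprMn; apply: ldvd_mulr.
have lrad_ldvd x y : ldvd M x y -> lrad M c x -> lrad M c y.
  by move=> h [n hx]; exists n; apply: ldvd_trans hx (ldvdX _ h).
split; last 1 first.
(* If [a] divides [b], then [a b] divides [b^2], which puts [b] in the radical. *)
- move=> a b [n h]; have [hab|hba] := totM a b; [right | left].
    exists (n + n)%N; rewrite exprD; apply: (ldvd_trans h); rewrite exprMn.
    by apply: ldvd_mul; [apply: ldvdX | apply: ldvd_refl].
  exists (n + n)%N; rewrite exprD; apply: (ldvd_trans h); rewrite exprMn.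
  by apply: ldvd_mul; [apply: ldvd_refl | apply: ldvdX].
- split=> //.
  + by exists 1%N; rewrite expr1 -(mul0r c); apply: ldvd_mull.
  + move=> a b ha hb; have [h|h] := totM a b.
      by apply: lrad_ldvd ha; apply: ldvdD => //; apply: ldvd_refl.
    by apply: lrad_ldvd hb; apply: ldvdD => //; apply: ldvd_refl.
- by exists 1 => h; apply: n1; apply: (lrad_sub Mc).
Qed.

Lemma lrad_minimal c : M c -> minimal_prime_of (genI [:: c]) (lrad M c).
Proof.
move=> Mc; have pL := lrad_prime Mc; split=> //.
  by apply: genI1_sub; [apply: prime_is_ideal | apply: lrad_self].
move=> Q pQ cQ QL a; split; first exact: QL.
apply: lrad_least => //; first by move=> x /QL; apply: lrad_sub.
by apply: cQ; apply: mem_genI; rewrite inE.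
Qed.

End Total.
End Prime.
End LocalDivisibility.

(** * Localizing closures and primes in a PvMD *)

Section PvMD.
Context {R : idomainType} {K : fieldType} {iota : {rmorphism R -> K}}.
Context (iota_inj : injective iota).
Context (quot : forall x : K, exists a b : R, b != 0 /\ x = iota a / iota b).
Context (hPvMD : PvMD iota).
Implicit Types (I M N P Q : R -> Prop) (s : seq R) (x : K).
Local Notation inR := (inR iota).
Local Notation vclos := (vclos iota).
Local Notation tclos := (tclos iota).
Local Notation t_ideal := (t_ideal iota).
Local Notation t_prime := (t_prime iota).
Local Notation t_maximal := (t_maximal iota).

Lemma t_maximal_ltotal M : t_maximal M -> ltotal M.
Proof.
move=> tM a b; have pM := t_maximal_prime tM.
have key (x y p t : R) : ~ M t -> y != 0 -> iota x / iota y = iota p / iota t -> ldvd M y x.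
  move=> nt ny e; have nt0 := prime_neq0 pM nt.
  exists t, p; split=> //; apply: iota_inj; rewrite !rmorphM mulrC.
  by apply/eqP; rewrite -eqr_div ?iota_eq0 //; apply/eqP.
have [->|na] := eqVneq a 0; first by right; rewrite -(mul0r b); apply: ldvd_mull.
have [->|nb] := eqVneq b 0; first by left; rewrite -(mul0r a); apply: ldvd_mull.
have [|[p [t [nt e]]]|[p [t [nt e]]]] := hPvMD tM (x := iota a / iota b).
- by rewrite mulf_eq0 invr_eq0 !iota_eq0 // negb_or na.
- by right; apply: key e.
- by left; apply: (key b a p t) => //; rewrite -e invf_div.
Qed.

Lemma inR_ldvd p q : q != 0 -> (forall M, t_maximal M -> ldvd M q p) ->
  inR (iota p / iota q).
Proof.
move=> nq h; apply: inR_local => // M tM; have [t [c [nt e]]] := h M tM.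
by exists t => //; exists c; rewrite mulrA -rmorphM e rmorphM mulfK // iota_eq0.
Qed.

(** In a PvMD, [I_t] is the intersection of the [I R_M]. If [r] is in [J_v] with [J] finitely
    generated in [I], then [J R_M = a R_M] for some generator [a], so [t/a] is in [(R : J)] for some
    [t] outside [M], and [t r] is in [aR]. *)
Lemma tclosP I r : is_ideal I -> nonzeroI I ->
  (tclos I r <-> forall M, t_maximal M -> exists2 t, I (t * r) & ~ M t).
Proof.
move=> iI nzI; split=> [[s [/subI_genI sI nz /vclosP hr]] M tM|]; last exact: tclos_local.
have pM := t_maximal_prime tM.
have [a [sa na /(ldvd_common_denom pM) [t nt ht]]] :=
  ldvd_min pM (t_maximal_ltotal tM) (nonzero_genI nz).
exists t => //; have [|r' e] := hr (iota t / iota a).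
  move=> b /ht [c ec]; exists c.
  by rewrite mulrA -rmorphM mulrC [b * t]mulrC ec rmorphM mulrC mulfK // iota_eq0.
suff -> : t * r = r' * a by apply/(idealM iI)/sI.
by apply: iota_inj; rewrite !rmorphM -e mulrA divfK ?iota_eq0 // mulrC.
Qed.

Lemma vclos_genI_tclos s r : nonzeroI (genI s) -> vclos (genI s) r <-> tclos (genI s) r.
Proof.
move=> nz; split=> [h|/tclos_seq [s' s's /vclos_sub h]]; first by exists s; split=> // a.
by move=> x hx; apply: h s's _ _ => a /hx; rewrite mulrC.
Qed.

Lemma vclos_localP s r : nonzeroI (genI s) ->
  (vclos (genI s) r <-> forall M, t_maximal M -> exists2 t, genI s (t * r) & ~ M t).
Proof. by move=> nz; rewrite vclos_genI_tclos //; apply: tclosP => //; apply: genI_ideal. Qed.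

Lemma genI_ldvd M s a r : a \in s -> ldvd M a r -> exists2 t, genI s (t * r) & ~ M t.
Proof.
move=> sa [t [c [nt e]]]; exists t => //; rewrite e.
by apply: (idealM (genI_ideal s)); apply: mem_genI.
Qed.

(** If [r] is in [P_t], then [t r] is in [P] for some [t] outside [M], hence outside [P]. *)
Lemma prime_t_prime P M : prime_ideal P -> nonzeroI P -> t_maximal M -> subI P M -> t_prime P.
Proof.
move=> pP nzP tM PM; have iP := prime_is_ideal pP; split=> //; split=> // r.
split; last exact: sub_tclos.
move=> /(tclosP _ iP nzP) /(_ M tM) [t Ptr nt].
by apply: (primeMl pP Ptr) => /PM.
Qed.

Lemma t_ideal_vclos I s r : t_ideal I -> subseqI s I -> vclos (genI s) r -> I r.
Proof. by move=> [iI nzI tI] sI hr; apply/tI; apply: sub_tclos_seq hr. Qed.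

Lemma vclos_t_closed s r : tclos (vclos (genI s)) r -> vclos (genI s) r.
Proof.
move=> /tclos_seq [s' s's /vclos_sub h] x hx.
by apply: h s's _ _ => a; apply.
Qed.

Lemma vclos_principal a : a != 0 -> vclos (genI [:: a]) = genI [:: a].
Proof.
move=> na; apply: eqI_eq => r; split; last exact: sub_vclos.
move=> /vclosP /(_ (iota a)^-1) [b|c e].
  by rewrite inE => /eqP->; exists 1; rewrite rmorph1 divff // iota_eq0.
apply/genI1P; exists c; apply: iota_inj.
by rewrite rmorphM -e divfK // iota_eq0.
Qed.

(** Otherwise [P] contains a unit family, and a common [c] outside [P] sends a power of each member
    [b] into [I]. At each t-maximal ideal some [b] is a unit, so [c] is in [I_t], hence in [I] and
    in [P]. *)
Lemma minimal_prime_t_maximal I P : is_ideal I -> nonzeroI I ->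
  subI (tclos I) I -> minimal_prime_of I P -> exists2 M, t_maximal M & subI P M.
Proof.
move=> iI nzI tI mP; have [pP IP _] := mP; apply: contrapT => nM.
have [|M tM|s sP us] := unit_family_ex (iota := iota) (prime_is_ideal pP).
- by case: nzI => a [/IP Pa na]; exists a.
- apply: contrapT => h; apply: nM; exists M => // a Pa.
  by apply: contrapT => na; apply: h; exists a.
have [c [n [nc hc]]] : exists c n, ~ P c /\ forall b, b \in s -> I (c * b ^+ n).
  elim: s sP {us} => [|b s ih] h.
    by exists 1, 0%N; split=> //; apply: prime_nunit.
  have [|c [n [nc hc]]] := ih; first by move=> x xs; apply: h; rewrite inE xs orbT.
  have [d [m [nd hd]]] := minimal_prime_pow iI mP (h b (mem_head _ _)).
  exists (c * d), (n + m)%N; split; first exact: primeM.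
  move=> x; rewrite inE => /orP [/eqP->|/hc hx]; rewrite exprD mulrACA.
    exact: (idealM iI).
  exact: (ideal_mulr iI).
apply: nc; apply: IP; apply: tI; apply/tclosP => // M tM.
have [b sb nb] := unit_family_t_maximal tM us.
exists (b ^+ n); first by rewrite mulrC; apply: hc.
by move/(primeX (t_maximal_prime tM)).
Qed.

Section FinitelyGenerated.
Context {s : seq R} (nzs : nonzeroI (genI s)).

Lemma nonzero_vclos : nonzeroI (vclos (genI s)).
Proof. by case: nzs => a [/sub_vclos ha na]; exists a. Qed.

Lemma minimal_prime_vclos_t_maximal P :
  minimal_prime_of (vclos (genI s)) P -> exists2 M, t_maximal M & subI P M.
Proof.
apply: minimal_prime_t_maximal; [exact: vclos_ideal|exact: nonzero_vclos|].
exact: vclos_t_closed.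
Qed.

Lemma nonzero_above P : subI (genI s) P -> nonzeroI P.
Proof. by move=> sP; case: nzs => a [/sP Pa na]; exists a. Qed.

(** Every prime that competes here lies in a t-maximal ideal and is therefore a t-prime; and a
    t-prime contains [J_v] as soon as it contains the finitely generated [J]. *)
Lemma minimal_prime_vclosE P :
  minimal_prime_of (vclos (genI s)) P <-> minimal_tprime_of iota (genI s) P.
Proof.
split=> [mP|[tP sP minP]].
  have [pP vP minP] := mP; have [M tM PM] := minimal_prime_vclos_t_maximal mP.
  have sP : subI (genI s) P by move=> a /(sub_vclos (iota := iota)); apply: vP.
  split=> //; first by apply: (prime_t_prime pP (nonzero_above sP) tM PM).
  move=> Q [pQ tQ] sQ; apply: minP => // a; apply: t_ideal_vclos tQ _.
  exact: subI_genI.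
have [M tM PM] := t_prime_t_maximal tP; have [pP tIP] := tP.
split=> //; first by move=> a; apply: t_ideal_vclos tIP _; apply: subI_genI.
move=> Q pQ vQ QP; have sQ : subI (genI s) Q by move=> a /(sub_vclos (iota := iota)); apply: vQ.
apply: minP => //; apply: (prime_t_prime pQ (nonzero_above sQ) tM).
by move=> a /QP /PM.
Qed.

End FinitelyGenerated.

Lemma minimal_prime_principal_t_prime a P : a != 0 -> minimal_prime_of (genI [:: a]) P ->
  t_prime P.
Proof.
move=> na; have nz : nonzeroI (genI [:: a]) by apply: (genI_nonzero (x := a)); rewrite ?inE.
by rewrite -vclos_principal // => /(minimal_prime_vclosE nz) [].
Qed.

End PvMD.

(** * Finite collections of primes *)

Section Finiteness.
Context {R : idomainType}.
Implicit Types (F G : (R -> Prop) -> Prop) (P Q : R -> Prop).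

Lemma finitely_many_sub F G : (forall P, F P -> G P) -> finitely_many G -> finitely_many F.
Proof. by move=> FG [L hL]; exists L => P /FG /hL. Qed.

Lemma finitely_many_bigU (T : eqType) (s : seq T) (F : T -> (R -> Prop) -> Prop) :
  (forall a, a \in s -> finitely_many (F a)) ->
  finitely_many (fun P => exists2 a, a \in s & F a P).
Proof.
elim: s => [_|a s ih h]; first by exists [::] => P [].
have [L hL] := h a (mem_head _ _).
have [|L' hL'] := ih; first by move=> x xs; apply: h; rewrite inE xs orbT.
exists (L ++ L') => P [x]; rewrite inE => /orP [/eqP-> /hL [Q LQ]|xs FP].
  by exists Q => //; apply/Stdlib.Lists.List.in_or_app; left.
by have [|Q LQ] := hL' P; [exists x | exists Q => //; apply/Stdlib.Lists.List.in_or_app; right].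
Qed.

End Finiteness.

(** * Branched t-primes, minimal primes and v-finite ideals *)

Section Equivalences.
Context {R : idomainType} {K : fieldType} {iota : {rmorphism R -> K}}.
Context (iota_inj : injective iota).
Context (quot : forall x : K, exists a b : R, b != 0 /\ x = iota a / iota b).
Context (hPvMD : PvMD iota).
Implicit Types (I M N P Q : R -> Prop) (s : seq R) (a b c : R).
Local Notation inR := (inR iota).
Local Notation vclos := (vclos iota).
Local Notation tclos := (tclos iota).
Local Notation t_ideal := (t_ideal iota).
Local Notation t_prime := (t_prime iota).
Local Notation t_maximal := (t_maximal iota).
Local Notation prodColon := (prodColon iota).
Let t_max_total := t_maximal_ltotal iota_inj hPvMD.

Lemma t_prime_ltotal P : t_prime P -> ltotal P.
Proof. by move=> /t_prime_t_maximal [M tM PM]; apply: ltotal_antimono PM (t_max_total tM). Qed.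

Lemma primary_proper_elt Q P : primary_for Q P -> ~ eqI Q P -> exists2 b, P b & ~ Q b.
Proof.
move=> [iQ pQ _ radQ] ne; apply: contrapT => h; apply: ne => a; split=> [Qa|Pa].
  by apply/radQ; exists 0%N; rewrite expr1.
by apply: contrapT => na; apply: h; exists a.
Qed.

(** Choose [b] in [P] outside the primary ideal [Q]. For [c] in [P] some power of [c] is in [Q], and
    in [R_P] it cannot divide [b], as [b] would then be in [Q]; so [b] divides it, and any prime
    inside [P] containing [b] contains [c]. *)
Lemma branched_t_prime_minimal P : t_prime P -> branched P ->
  exists2 b, b != 0 & minimal_prime_of (genI [:: b]) P.
Proof.
move=> tP [pP [Q [hQ ne]]]; have [b Pb nb] := primary_proper_elt hQ ne.
have [iQ _ primQ radQ] := hQ; exists b.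
  by apply/eqP => b0; apply: nb; rewrite b0; apply: ideal0 iQ.
split=> //; first by apply: genI1_sub => //; exact: prime_is_ideal.
move=> N pN bN NP c; split; first exact: NP.
move=> /radQ [n Qcn]; have [h|[t [d [nt e]]]] := t_prime_ltotal tP b (c ^+ n.+1).
  apply: (primeX pN (n := n.+1)); apply: ldvd_prime h _ => //.
  by apply: bN; apply: mem_genI; rewrite inE.
case: nt; apply/radQ; apply: primQ nb.
by rewrite mulrC e; apply: (idealM iQ).
Qed.

(** The primary ideal is the contraction of [a^2 R_P]. Its radical is [P] by minimality, and it
    misses [a] because [a] is not a unit in [R_P]. *)
Lemma minimal_prime_principal_branched a P : a != 0 ->
  minimal_prime_of (genI [:: a]) P -> branched P.
Proof.
move=> na mP; have tP := minimal_prime_principal_t_prime iota_inj hPvMD na mP.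
have [pP aP minP] := mP; have iP := prime_is_ideal pP.
have Pa : P a by apply: aP; apply: mem_genI; rewrite inE.
have QP x : ldvd P (a * a) x -> P x.
  by move=> h; apply: ldvd_prime h _ => //; apply: (idealM iP).
have radQ : eqI (radical (ldvd P (a * a))) P.
  move=> x; split=> [[n /QP]|Px]; first exact: primeX.
  have [c [n [nc hc]]] := minimal_prime_pow (genI_ideal _) mP Px.
  have h : ldvd P a (x ^+ n) by exists c; move/genI1P: hc => [r e]; exists r.
  (* [radical] uses the exponent [n.+1], so one factor [x] is left over beside [x^n x^n]. *)
  by exists (n + n)%N; rewrite exprS exprD; apply: (ldvd_mulr pP); apply: ldvd_mul.
split=> //; exists (ldvd P (a * a)); split.
  split=> //.
  - split; first by rewrite -(mul0r (a * a)); apply: ldvd_mull.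
      by move=> x y; apply: ldvdD.
    by move=> r x; apply: ldvd_mulr.
  - by exists 1 => /QP; apply: prime_nunit.
  - move=> x y [t [d [nt e]]] nx; apply/radQ; apply: contrapT => ny; apply: nx.
    exists (t * y), d; split; first exact: primeM.
    by rewrite -e; ring.
move=> /(_ a) [_ /(_ Pa) [t [d [nt e]]]]; apply: nt.
suff -> : t = d * a by apply: (idealM iP).
by apply: (mulIf na); rewrite e mulrA.
Qed.

(* [D = (R : (1, x))] is v-finite: at each t-maximal ideal, [D + x D] contains a
   unit, so finitely many elements of [D] suffice to generate [D] locally. *)
Lemma denom_v_finite (x : K) : exists s, nonzeroI (genI s) /\
  forall r, vclos (genI s) r <-> inR (iota r * x).
Proof.
pose D r := inR (iota r * x); have iD : is_ideal D := denom_ideal x.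
pose E e := exists r r', [/\ D r, D r' & iota e = iota r + iota r' * x].
have iE : is_ideal E.
  split.
  - by exists 0, 0; split; rewrite ?rmorph0 ?mul0r ?addr0 //; apply: ideal0 iD.
  - move=> a b [r [r' [hr hr' ea]]] [t [t' [ht ht' eb]]].
    exists (r + t), (r' + t'); split; [exact: (idealD iD)..|].
    by rewrite !rmorphD ea eb; ring.
  - move=> c a [r [r' [hr hr' ea]]]; exists (c * r), (c * r').
    by split; [exact: (idealM iD)..|]; rewrite !rmorphM ea; ring.
have DE r : D r -> E r.
  move=> Dr; exists r, 0; split=> //; first exact: ideal0 iD.
  by rewrite rmorph0 mul0r addr0.
have [d [Dd nd]] := denom_nonzero quot iota_inj x.
have [||s sE us] := unit_family_ex (iota := iota) iE.
- by exists d; split=> //; apply: DE.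
- move=> M tM; have [p [q [nq ex]]] := quot x.
  have nq' : iota q != 0 by rewrite iota_eq0.
  (* With [x = p/q]: either [t x = c], so [t] is in [D], or [c x = t], so [c] is in [D] and [t] is
     in [x D]. *)
  have [[t [c [nt e]]]|[t [c [nt e]]]] := t_max_total tM q p.
    exists t => //; apply: DE; exists c.
    by rewrite ex mulrA -rmorphM e rmorphM mulfK.
  have et : iota c * x = iota t by rewrite ex mulrA -rmorphM -e rmorphM mulfK.
  exists t => //; exists 0, c; split; first exact: ideal0 iD.
    by exists t.
  by rewrite rmorph0 add0r et.
have [F FD hF] : exists2 F, subseqI F D & forall e, e \in s ->
    exists r r', [/\ r \in F, r' \in F & iota e = iota r + iota r' * x].
  elim: s sE {us} => [|e s ih] h; first by exists [::].
  have [|F FD hF] := ih; first by move=> y ys; apply: h; rewrite inE ys orbT.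
  have [r [r' [Dr Dr' ee]]] := h e (mem_head _ _).
  exists [:: r, r' & F]; first by move=> y; rewrite !inE => /or3P [/eqP->|/eqP->|/FD].
  move=> y; rewrite inE => /orP [/eqP->|/hF [t [t' [ht ht' et]]]].
    by exists r, r'; rewrite !inE !eqxx orbT.
  by exists t, t'; rewrite !inE ht ht' !orbT.
have nz : nonzeroI (genI (d :: F)) by apply: (genI_nonzero (x := d)); rewrite ?inE ?eqxx.
exists (d :: F); split=> // r; split.
  by move/vclosP; apply => a; rewrite inE => /orP [/eqP->|/FD].
move=> [w ew]; apply/(vclos_localP iota_inj hPvMD) => // M tM.
have pM := t_maximal_prime tM.
have [e es ne] := unit_family_t_maximal tM us.
have [r1 [r2 [hr1 hr2 ee]]] := hF e es; have [w2 ew2] := FD _ hr2.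
(* A unit [e = r1 + r2 x] at [M] has a unit summand. If it is [w2 = r2 x], then [w2 r = w r2] shows
   that [r2] divides [r]. *)
have [Mr1|nr1] := EM (M r1); last first.
  by apply: (genI_ldvd (a := r1)); [rewrite inE hr1 orbT | apply: ldvd_out].
apply: (genI_ldvd (a := r2)); first by rewrite inE hr2 orbT.
exists w2, w; split.
  move=> Mw2; apply: ne; suff -> : e = r1 + w2 by apply: (idealD (prime_is_ideal pM)).
  by apply: iota_inj; rewrite ee ew2 rmorphD.
by apply: iota_inj; rewrite !rmorphM -ew -ew2; ring.
Qed.

(** * The trace ideal [I (R : I)] *)

Section Trace.
Context {I : R -> Prop} (iI : is_ideal I).

Lemma colonR_denom x a : colonR iota I x -> I a -> inR (iota a * x).
Proof. by move=> hx Ia; rewrite mulrC; apply: hx. Qed.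

Lemma prodColon_intro r a x : I a -> colonR iota I x -> iota r = iota a * x ->
  prodColon I r.
Proof.
move=> Ia hx e; exists [:: (a, x)]; rewrite big_seq1; split=> // p.
by rewrite inE => /eqP->.
Qed.

Lemma sub_prodColon : subI I (prodColon I).
Proof.
move=> a Ia; apply: (prodColon_intro (a := a) (x := 1)) => //; last by rewrite mulr1.
by move=> b _; rewrite mul1r; apply: inR_iota.
Qed.

Lemma prodColon_ideal : is_ideal (prodColon I).
Proof.
split.
- by apply: sub_prodColon; apply: ideal0 iI.
- move=> a b [s [hs ea]] [t [ht eb]]; exists (s ++ t); split.
    by move=> p; rewrite mem_cat => /orP [/hs|/ht].
  by rewrite rmorphD ea eb big_cat.
- move=> r a [s [hs ea]]; exists [seq (r * p.1, p.2) | p <- s]; split.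
    by move=> _ /mapP [p /hs [Ip cp] ->]; split=> //; apply: (idealM iI).
  rewrite big_map rmorphM ea mulr_sumr; apply: eq_bigr => p _.
  by rewrite rmorphM mulrA.
Qed.

Lemma nonzero_prodColon : nonzeroI I -> nonzeroI (prodColon I).
Proof. by move=> [a [/sub_prodColon Ta na]]; exists a. Qed.

End Trace.

Lemma tRTP_radical_v_finite P : tRTP iota -> t_prime P -> branched P ->
  exists s, nonzeroI (genI s) /\ eqI P (radical (vclos (genI s))).
Proof.
move=> rtp tP [pP [Q [hQ ne]]]; have [b Pb nb] := primary_proper_elt hQ ne.
have [iQ _ primQ radQ] := hQ; have [_ [_ [p0 [Pp0 np0]] _]] := tP.
have nzQ : nonzeroI Q.
  by have /radQ [n Qn] := Pp0; exists (p0 ^+ n.+1); rewrite expf_neq0.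
have iT := prodColon_ideal iQ; have nzT := nonzero_prodColon nzQ.
(* A radical t-closure of the trace contains [Q], hence its radical [P]. *)
have PT : subI P (tclos (prodColon Q)).
  have [all_|radT] := rtp Q iQ nzQ; first by move=> a _.
  move=> a /radQ [n Qn]; apply: radT; exists n; apply: sub_tclos => //.
  exact: sub_prodColon.
have [M tM PM] := t_prime_t_maximal tP.
have /(tclosP iota_inj hPvMD _ iT nzT) /(_ M tM) [t [ps [hps e]] nt] := PT b Pb.
(* Otherwise one [u] outside [P] clears all colon factors in the sum for [t b]. This puts [u t b] in
   [Q] with [b] outside [Q], so [u t] is in [P], a contradiction. *)
have [x hx nx] : exists2 x, colonR iota Q x & forall u, inR (iota u * x) -> P u.
  apply: contrapT => h.
  have [u nu hu] : exists2 u, ~ P u & forall p, p \in ps -> inR (iota u * p.2).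
    have hc p : p \in ps -> exists2 u, ~ P u & inR (iota u * p.2).
      move=> /hps [_ hp]; apply: contrapT => hu; apply: h; exists p.2 => // u hpu.
      by apply: contrapT => nu; apply: hu; exists u.
    elim: ps {e hps} hc => [|p ps ih] hc; first by exists 1 => //; apply: prime_nunit.
    have [|u nu hu] := ih; first by move=> q qs; apply: hc; rewrite inE qs orbT.
    have [v nv hv] := hc p (mem_head _ _).
    exists (u * v); first exact: primeM.
    move=> q; rewrite inE => /orP [/eqP->|/hu hq]; first exact: (idealM (denom_ideal _)).
    exact: (ideal_mulr (denom_ideal _)).
  have Qub : Q (b * (u * t)).
    have [s [eqs hs]] : exists s : R, iota s = \sum_(p <- ps) iota p.1 * (iota u * p.2) /\ Q s.
      rewrite big_seq; elim/big_ind: _ => [|_ _ [a [<- Qa]] [c [<- Qc]]|p pps].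
      - by exists 0; rewrite rmorph0; split=> //; apply: ideal0 iQ.
      - by exists (a + c); rewrite rmorphD; split=> //; apply: (idealD iQ).
      - have [w ->] := hu p pps; have [Qp _] := hps p pps.
        by exists (p.1 * w); rewrite rmorphM; split=> //; apply: (ideal_mulr iQ).
    suff -> : b * (u * t) = s by [].
    apply: iota_inj; rewrite eqs mulrCA [b * t]mulrC rmorphM e mulr_sumr.
    by apply: eq_bigr => p _; rewrite mulrCA.
  have /radQ := primQ _ _ Qub nb.
  by apply: primeM => // /PM.
have [s [nzs hs]] := denom_v_finite x; exists s; split=> // r; split.
  by move=> /radQ [n Qn]; exists n; apply/hs; apply: colonR_denom Qn.
by move=> [n /hs /nx]; apply: primeX.
Qed.

Lemma radical_v_finite_avoids P s : t_prime P -> eqI P (radical (vclos (genI s))) ->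
  subI (genI s) P /\ forall M, t_maximal M -> ~ subI P M -> ~ subI (genI s) M.
Proof.
move=> tP eP; split=> [a sa|M tM nPM /subI_genI sM].
  by apply/eP; exists 0%N; rewrite expr1; apply: sub_vclos.
apply: nPM => a /eP [n han]; apply: (primeX (t_maximal_prime tM) (n := n.+1)).
by have [tiM _ _] := tM; apply: t_ideal_vclos tiM sM han.
Qed.

(** Add to [s] an element [b] over which [P] is minimal. At [M] containing [P], [b] divides a power
    of [c]: it does so at [P], and one more factor [c] lifts this to [R_M]. At any other [M] the
    family [s] contains a unit. *)
Lemma avoids_radical_v_finite P s : t_prime P -> branched P -> subI (genI s) P ->
    (forall M, t_maximal M -> ~ subI P M -> ~ subI (genI s) M) ->
  exists s', nonzeroI (genI s') /\ eqI P (radical (vclos (genI s'))).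
Proof.
move=> tP bP sP avoid; have [b nb mP] := branched_t_prime_minimal tP bP.
have [pP bP' _] := mP; have [_ tiP] := tP.
have Pb : P b by apply: bP'; apply: mem_genI; rewrite inE.
have nz : nonzeroI (genI (b :: s)) by apply: (genI_nonzero (x := b)); rewrite ?inE ?eqxx.
exists (b :: s); split=> // c; split=> [Pc|[n hc]]; last first.
  apply: (primeX pP (n := n.+1)); apply: t_ideal_vclos tiP _ hc.
  by move=> a; rewrite inE => /orP [/eqP->|/mem_genI /sP].
have [d [n [nd /genI1P [r e]]]] := minimal_prime_pow (genI_ideal _) mP Pc.
exists n; apply/(vclos_localP iota_inj hPvMD) => // M tM; have pM := t_maximal_prime tM.
have [PM|nPM] := EM (subI P M).
  apply: (genI_ldvd (a := b)); first exact: mem_head.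
  rewrite exprSr; apply: (ldvd_lift (t_max_total tM) pP) => //.
  by exists d, r.
have [a sa na] : exists2 a, a \in s & ~ M a.
  apply: contrapT => h; apply: (avoid M tM nPM).
  apply: genI_sub; first exact: prime_is_ideal.
  by move=> a sa; apply: contrapT => na; apply: h; exists a.
by apply: (genI_ldvd (a := a)); [rewrite inE sa orbT | apply: ldvd_out].
Qed.

Lemma radical_v_finite_finitely_many a : a != 0 ->
    (forall P, t_prime P -> branched P ->
      exists s, nonzeroI (genI s) /\ eqI P (radical (vclos (genI s)))) ->
  finitely_many (minimal_prime_of (genI [:: a])).
Proof.
move=> na c3; set mp := minimal_prime_of _.
have mp_t_prime P : mp P -> t_prime P by apply: minimal_prime_principal_t_prime.
(* [S] holds of [s] when finitely many minimal primes of [a] suffice to have one below each t-prime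
   containing [s]. Unit families satisfy it vacuously. *)
pose S s := exists L : seq (R -> Prop), (forall P, Stdlib.Lists.List.In P L -> mp P) /\
  forall P, t_prime P -> subseqI s P -> exists2 Q, Stdlib.Lists.List.In Q L & subI Q P.
have unit_S s : unit_family iota s -> S s.
  move=> us; exists [::]; split=> // P [[_ pP _] tP] sP.
  by case: (t_ideal_unit_family tP pP us sP).
apply: contrapT => nfin.
have [||||N [pN aN nSN _]] := @krull _ S (genI [:: a]).
- exact: genI_ideal.
- by exists [:: 1]; apply: unit_S; apply/sub_vclos/mem_genI; rewrite inE.
- move=> s s' [L [mL hL]] [L' [mL' hL']]; exists (L ++ L'); split.
    by move=> P hP; have [/mL|/mL'] := Stdlib.Lists.List.in_app_or _ _ _ hP.
  move=> P tP /(prime_mulseq (proj1 tP)) [/(hL _ tP)|/(hL' _ tP)] [Q LQ QP].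
    by exists Q => //; apply/Stdlib.Lists.List.in_or_app; left.
  by exists Q => //; apply/Stdlib.Lists.List.in_or_app; right.
(* If [s] lies in [aR], the list applies to every minimal prime of [a] and by minimality contains
   it. *)
- move=> s [L [mL hL]] sa; apply: nfin; exists L => P mP.
  have [pP aP minP] := mP.
  have [|Q LQ QP] := hL P (mp_t_prime _ mP); first by move=> x /sa /aP.
  have [pQ aQ _] := mL _ LQ; exists Q => // x.
  by have [h1 h2] := minP Q pQ aQ QP x; split.
have Na : N a by apply: aN; apply: mem_genI; rewrite inE.
have [||M [tM pM NM]] := t_maximal_ex (iota := iota) (prime_is_ideal pN).
- by exists a.
- by move=> s /unit_S; apply: nSN.
(* This minimal prime lies inside [N]. The family whose v-closure has it as radical satisfies [S]
   with a one-element list, yet is contained in [N]. *)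
have mP : mp (lrad M a) := lrad_minimal pM (t_max_total tM) (NM _ Na).
have tP := mp_t_prime _ mP.
have [s [nzs eP]] := c3 _ tP (minimal_prime_principal_branched na mP).
apply: (nSN s).
  exists [:: lrad M a]; split=> [P [<-|[]] //|P [pP tiP] sP].
  exists (lrad M a); first by left.
  move=> x /eP [n hx]; apply: (primeX pP (n := n.+1)).
  exact: t_ideal_vclos tiP sP hx.
have [+ _] := radical_v_finite_avoids tP eP.
move=> /subI_genI sP x /sP; apply: lrad_least => //.
Qed.

(** At a t-maximal ideal over [P] the ideal of [s] is generated by one nonzero entry, so each
    minimal t-prime already comes from a principal ideal. *)
Lemma minimal_t_prime_generator s P : minimal_tprime_of iota (genI s) P -> nonzeroI (genI s) ->
  exists2 a, a \in [seq a <- s | a != 0] & minimal_prime_of (genI [:: a]) P.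
Proof.
move=> [tP sP minP] nz; have [M tM PM] := t_prime_t_maximal tP; have [pP _] := tP.
have [a [sa na ha]] := ldvd_min (t_maximal_prime tM) (t_max_total tM) (nonzero_genI nz).
exists a; first by rewrite mem_filter na.
split=> //; first by apply: genI1_sub; [apply: prime_is_ideal | apply/sP/mem_genI].
move=> Q pQ aQ QP.
have Qa : Q a by apply: aQ; apply: mem_genI; rewrite inE.
have QM : subI Q M by move=> x /QP /PM.
apply: minP => //; first by apply: (prime_t_prime iota_inj hPvMD pQ _ tM QM); exists a.
apply: genI_sub; first exact: prime_is_ideal.
by move=> b /ha h; apply: ldvd_prime h Qa.
Qed.

(** * From finitely many minimal primes to the trace property *)

Section SquareRoot.
Context (fin : forall a, a != 0 -> finitely_many (minimal_prime_of (genI [:: a]))).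

(* The minimal primes of [g] other than [P] do not lie in [M], so there is an
   element outside [M] that is divisible by [g] at every t-maximal ideal not
   containing [P]. *)
Lemma local_multiple_outside M P g : t_maximal M -> g != 0 ->
    (forall Q, minimal_prime_of (genI [:: g]) Q -> subI Q M -> subI P Q) ->
  exists2 e, ~ M e & forall N, t_maximal N -> ~ subI P N -> ldvd N g e.
Proof.
move=> tM ng hP; have pM := t_maximal_prime tM; have [L hL] := fin ng.
have [e ne he] : exists2 e, ~ M e & forall Q, Stdlib.Lists.List.In Q L ->
    minimal_prime_of (genI [:: g]) Q -> ~ subI P Q ->
    forall N, t_maximal N -> subI Q N -> ldvd N g e.
  elim: L {hL} => [|Q L [e ne he]]; first by exists 1 => //; apply: prime_nunit.
  have [[mQ nPQ]|h] := EM (minimal_prime_of (genI [:: g]) Q /\ ~ subI P Q); last first.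
    by exists e => // Q' [<- mQ nPQ|/he //]; case: h.
  have [pQ _ _] := mQ.
  have [z Qz nz] : exists2 z, Q z & ~ M z.
    apply: contrapT => h; apply: nPQ; apply: hP => // z Qz.
    by apply: contrapT => nz; apply: h; exists z.
  have [d [n [nd /genI1P [r er]]]] := minimal_prime_pow (genI_ideal _) mQ Qz.
  (* In [R_Q] the power [z^n] is a multiple of [g]; the last factor [z], taken from [Q], lifts this
     to [R_N]. *)
  exists (e * z ^+ n.+1).
    by apply: primeM => // /(primeX pM).
  move=> Q' [<- _ _ N tN QN|LQ' mQ' nPQ' N tN QN]; have pN := t_maximal_prime tN.
    apply: (ldvd_mulr pN); rewrite exprSr.
    by apply: (ldvd_lift (t_max_total tN) pQ) => //; exists d, r.
  by rewrite mulrC; apply: (ldvd_mulr pN); apply: he LQ' _ _ _ _ QN.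
exists e => // N tN nPN; have pN := t_maximal_prime tN.
have [Ng|nNg] := EM (N g); last exact: ldvd_out.
have mp := lrad_minimal pN (t_max_total tN) Ng.
have [Q LQ /eqI_eq eQ] := hL _ mp.
have NQ : subI Q N by rewrite -eQ; apply: lrad_sub.
apply: (he Q LQ _ _ N tN NQ); first by rewrite -eQ.
by move=> PQ; apply: nPN => x /PQ /NQ.
Qed.

Lemma tclos_trace_sqrt I c : is_ideal I -> nonzeroI I ->
  tclos (prodColon I) (c * c) -> tclos (prodColon I) c.
Proof.
move=> iI nzI hcc; have iT := prodColon_ideal iI; have nzT := nonzero_prodColon nzI.
have [->|nc] := eqVneq c 0; first by apply: sub_tclos => //; apply: ideal0 iT.
apply/(tclosP iota_inj hPvMD) => // M tM; have pM := t_maximal_prime tM.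
have totM := t_max_total tM.
have /(tclosP iota_inj hPvMD _ iT nzT) /(_ M tM) [s Tscc ns] := hcc.
have [Mc|nMc] := EM (M c); last by exists (s * c); [rewrite -mulrA | apply: primeM].
pose P := lrad M c; have pP : prime_ideal P := lrad_prime pM totM Mc.
have PM : subI P M := lrad_sub pM Mc; have Pc : P c := lrad_self pM c.
have totP := ltotal_antimono PM totM.
pose g := s * (c * c).
have ng : g != 0 by rewrite !mulf_neq0 // (prime_neq0 pM ns).
have [ps [hps eg]] := Tscc.
have [a [x [w [Ia na hx ew hw]]]] : exists a x w,
    [/\ I a, a != 0, colonR iota I x, iota w = iota a * x & ldvd M w (c * c)].
  (* Each product in the sum for [g] lies in [R]. The nonzero one of least value at [M] divides [g],
     hence [c^2], since [s] is a unit there. *)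
  have [ws [hws esum]] : exists ws : seq R, (forall w, w \in ws ->
      exists a x, [/\ I a, colonR iota I x & iota w = iota a * x]) /\ g = \sum_(w <- ws) w.
    have {Tscc ng}: iota g = \sum_(p <- ps) iota p.1 * p.2 by [].
    elim: ps g hps {eg} => [|p ps ih] g hps.
      rewrite big_nil => /eqP; rewrite iota_eq0 // => /eqP->; exists [::].
      by rewrite big_nil.
    have [Ip cp] := hps p (mem_head _ _).
    have [v ev] := colonR_denom cp Ip.
    rewrite big_cons ev => eg; have [||ws [hws es]] := ih (g - v).
    - by move=> q qs; apply: hps; rewrite inE qs orbT.
    - by rewrite rmorphB eg addrC addKr.
    exists (v :: ws); split; last by rewrite big_cons -es addrC subrK.
    by move=> y; rewrite inE => /orP [/eqP->|/hws //]; exists p.1, p.2.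
  have [|w [sw nw hw]] := ldvd_min pM totM (s := ws).
    apply: contrapT => h; move: ng; rewrite esum big_seq big1 ?eqxx // => w sw.
    by apply/eqP; apply: contrapT => /negP nw; apply: h; exists w.
  have [a [x [Ia hx ew]]] := hws w sw; exists a, x, w; split=> //.
    by apply: contraNneq nw => a0; rewrite -(iota_eq0 iota_inj) ew a0 rmorph0 mul0r.
  have wg : ldvd M w g.
    rewrite esum big_seq; elim/big_ind: _ => //.
      by rewrite -(mul0r w); apply: ldvd_mull.
    by move=> y z; apply: ldvdD.
  by apply: (ldvd_trans pM wg); exists s, 1; rewrite mul1r.
(* If [a'] did not exist, three steps from [a] would give [c^3 | w | c^2] at [P]. *)
have [a' [Ia' na' ha']] : exists a', [/\ I a', a' != 0 &
    forall b, I b -> ~ ldvd P (c * b) a'].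
  apply: contrapT => h.
  have step b : I b -> b != 0 -> exists b', [/\ I b', b' != 0 & ldvd P (c * b') b].
    move=> Ib nb; apply: contrapT => h'; apply: h; exists b; split=> // b' Ib' hb'.
    apply: h'; exists b'; split=> //; apply: contraNneq nb => b0.
    have [t [d [nt]]] := hb'; rewrite b0 !mulr0 => /eqP; rewrite mulf_eq0.
    by rewrite (negbTE (prime_neq0 pP nt)).
  have [a1 [I1 n1 h1]] := step a Ia na.
  have [a2 [I2 n2 h2]] := step a1 I1 n1.
  have [a3 [I3 n3 h3]] := step a2 I2 n2.
  have hmul := ldvd_mul pP (ldvd_refl pP c).
  have h123 := ldvd_trans pP (ldvd_trans pP (hmul _ _ (hmul _ _ h3)) (hmul _ _ h2)) h1.
  (* Here [w3 = a3 x], so [a w3 = w a3]. As [c^3 a3] divides [a] at [P], cancelling [a3] shows that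
     [c^3] divides [w]. *)
  have [w3 ew3] := colonR_denom hx I3.
  have ew3a : a * w3 = w * a3.
    by apply: iota_inj; rewrite !rmorphM -ew3 ew; ring.
  have hw3 : ldvd P (c * (c * c)) w.
    apply: (ldvd_cancel n3); rewrite -ew3a [a * w3]mulrC.
    by apply: (ldvd_mulr pP); rewrite -!mulrA.
  have hcc3 := ldvd_trans pP hw3 (ldvd_antimono PM hw).
  apply: (prime_nunit pP); apply: (ldvd_prime pP (M := P) (a := c)) => //.
  by apply: (ldvd_cancel (c := c * c)); rewrite ?mulf_neq0 // mul1r.
(* By the choice of [a'], [c b / a'] lies in [P R_P], which is contained in [R_N]. *)
have above N b : t_maximal N -> subI P N -> I b -> ldvd N a' (c * b).
  move=> tN PN Ib; have pN := t_maximal_prime tN.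
  have [[t [r [nt e]]]|/(ha' _ Ib) //] := totP a' (c * b).
  have Pr : P r by apply: contrapT => nr; apply: (ha' _ Ib); exists r, t.
  have [t' [d [nt' e']]] := ldvd_out_in (t_max_total tN) pP PN nt Pr.
  exists t', d; split=> //; apply: (mulfI (prime_neq0 pP nt)).
  by rewrite [LHS]mulrCA e [LHS]mulrA e' -mulrA mulrCA.
have [|u nu hu] := ldvd_common_denom pM (a := a') (s := [seq c * p.1 | p <- ps]).
  by move=> _ /mapP [p /hps [Ip _] ->]; apply: above.
have [|e ne he] := local_multiple_outside tM ng (P := P).
  (* Since [s] is outside [M], a prime inside [M] containing [g = s c^2] contains [c], hence [P]. *)
  move=> Q [pQ gQ _] QM; apply: (lrad_least pQ QM).
  have : Q g by apply: gQ; apply: mem_genI; rewrite inE.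
  by move=> /(primeMl pQ) /(_ (fun Qs => ns (QM _ Qs))); rewrite -expr2; apply: primeX.
have na'0 : iota a' != 0 by rewrite iota_eq0.
exists (e * u); last exact: primeM.
apply: (prodColon_intro (a := a') (x := iota (e * u * c) / iota a')) => //; last first.
  by rewrite [RHS]mulrC divfK.
move=> b Ib; rewrite mulrAC -rmorphM; apply: (inR_ldvd iota_inj quot) => // N tN.
have pN := t_maximal_prime tN; have [PN|nPN] := EM (subI P N).
  by rewrite -mulrA; apply: (ldvd_mulr pN); apply: above.
have [t [d [nt ed]]] := he N tN nPN.
(* Expand [g] as its sum of products: [u] clears [c p.1 / a'], and [p.2] sends [b] into [R]. As [g]
   divides [e] at [N], this settles the t-maximal ideals not containing [P]. *)
have [v ev] : inR (iota (u * c * g * b) / iota a').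
  have -> : iota (u * c * g * b) / iota a' =
            \sum_(p <- ps) iota (u * (c * p.1)) / iota a' * (iota b * p.2).
    have -> : iota (u * c * g * b) = iota g * iota (u * c * b).
      by rewrite -rmorphM; congr (iota _); ring.
    rewrite eg -mulrA mulr_suml; apply: eq_bigr => p _; rewrite !rmorphM.
    by set y := (iota a')^-1; ring.
  rewrite big_seq; elim/big_ind: _ => [||p pps]; last 1 first.
  - have [Ip cp] := hps p pps; apply: inRM; last exact: (colonR_denom cp Ib).
    have [|d' ->] := hu (c * p.1); first exact: map_f.
    by exists d'; rewrite rmorphM mulfK.
  - by exists 0; rewrite rmorph0.
  - exact: inRD.
exists t, (d * v); split=> //; apply: iota_inj.
have -> : t * (e * u * c * b) = t * e * (u * c * b) by ring.
have -> : t * e * (u * c * b) = d * (u * c * g * b) by rewrite ed; ring.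
by rewrite -[d * v * a']mulrA !(rmorphM _ d) [iota (v * a')]rmorphM -ev divfK.
Qed.

Lemma finitely_many_tRTP : tRTP iota.
Proof.
move=> I iI nzI; right=> a [n].
have iT := tclos_ideal (iota := iota) (prodColon_ideal iI) (nonzero_prodColon nzI).
elim: n => [|n ih]; first by rewrite expr1.
move=> h; apply: ih; apply: tclos_trace_sqrt => //.
(* The square of [a^(n+1)] is [a^n a^(n+2)], so one square root lowers the exponent by one. *)
by rewrite -exprD addSnnS exprD; apply: (idealM iT).
Qed.

End SquareRoot.
End Equivalences.

(** * The implications between the six conditions *)

Theorem theorem1p8 (R : idomainType) (K : fieldType) (iota : {rmorphism R -> K})
  (iota_inj : injective iota)
  (quot : forall x : K, exists a b : R, b != 0 /\ x = iota a / iota b)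
  (notfield : ~ (forall x : K, inR iota x))
  (hPvMD : PvMD iota) :
  let c1 := tRTP iota in
  let c2 := forall P : R -> Prop, t_prime iota P -> branched P ->
       exists s : seq R, subI (genI s) P /\
         forall M, t_maximal iota M -> ~ subI P M -> ~ subI (genI s) M in
  let c3 := forall P : R -> Prop, t_prime iota P -> branched P ->
       exists s : seq R, nonzeroI (genI s) /\ eqI P (radical (vclos iota (genI s))) in
  let c4 := forall a : R, a != 0 -> finitely_many (minimal_prime_of (genI [:: a])) in
  let c5 := forall s : seq R, nonzeroI (genI s) ->
       finitely_many (minimal_tprime_of iota (genI s)) in
  let c6 := forall s : seq R, nonzeroI (genI s) ->
       finitely_many (minimal_prime_of (vclos iota (genI s))) in
  [/\ c1 <-> c2, c1 <-> c3, c1 <-> c4, c1 <-> c5 & c1 <-> c6].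
Proof.
move=> c1 c2 c3 c4 c5 c6.
have h13 : c1 -> c3 by move=> h1 P tP bP; apply: tRTP_radical_v_finite.
have h32 : c3 -> c2.
  move=> h3 P tP bP; have [s [_ eP]] := h3 P tP bP.
  by exists s; apply: radical_v_finite_avoids.
have h23 : c2 -> c3.
  move=> h2 P tP bP; have [s [sP avoid]] := h2 P tP bP.
  exact: avoids_radical_v_finite bP sP avoid.
have h34 : c3 -> c4 by move=> h3 a na; apply: (radical_v_finite_finitely_many iota_inj).
have h45 : c4 -> c5.
  move=> h4 s nz; apply: finitely_many_sub (finitely_many_bigU (s := [seq a <- s | a != 0]) _).
    by move=> P mP; apply: (minimal_t_prime_generator iota_inj hPvMD mP nz).
  by move=> a; rewrite mem_filter => /andP [na _]; apply: h4.
have h56 : c5 -> c6.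
  move=> h5 s nz; apply: finitely_many_sub (h5 s nz) => P.
  by move/(minimal_prime_vclosE iota_inj hPvMD nz).
have h64 : c6 -> c4.
  move=> h6 a na; rewrite -(vclos_principal iota_inj na); apply: h6.
  by apply: (genI_nonzero (x := a)); rewrite ?inE.
have h41 : c4 -> c1 by move=> h4; apply: finitely_many_tRTP.
by split; split=> h; tauto.
Qed.
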